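(* Let $p_1$ and $p_2$ be different primes, let $m\ge 3$, and let $k_1,\dots,k_m,\lambda_1,\dots,\lambda_m$ be positive integers with $k_1+\dots+k_m\le p_1p_2$. Then there does not exist a $(p_1p_2+1,m;k_1,\dots,k_m;\lambda_1,\dots,\lambda_m)$-GSEDF (in any abelian group of order $p_1p_2+1$).
   Context: Let $G$ be a finite abelian group of order $v$, written additively with identity $0$, let $m\ge 2$, and let $\lambda_1,\dots,\lambda_m$ be positive integers. For disjoint subsets $A,B\subseteq G$, let $\Delta(A,B)$ be the multiset $\{x-y : x\in A, y\in B\}$. A $(v,m;k_1,\dots,k_m;\lambda_1,\dots,\lambda_m)$-generalized strong external difference family (GSEDF) in $G$ is a collection $\{D_1,\dots,D_m\}$ of mutually disjoint nonempty subsets of $G$ with $|D_i|=k_i$ such that for every $i$, $1\le i\le m$, the multiset union $\bigcup_{1\le j\le m,\, j\ne i}\Delta(D_i,D_j)$ contains every element of $G\setminus\{0\}$ exactly $\lambda_i$ times and does not contain $0$. *)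

(* Defs.v *)
From mathcomp Require Import all_boot all_algebra.

Set Implicit Arguments.
Unset Strict Implicit.
Unset Printing Implicit Defensive.

Import GRing.Theory.
Local Open Scope nat_scope.

(* A multiset over G is represented by a sequence considered up to perm_eq;
   the multiplicity of g is count_mem g and multiset union, which adds
   multiplicities, is concatenation. *)

Definition Delta (G : finZmodType) (A B : {set G}) : seq G :=
  [seq (x - y)%R | x <- enum A, y <- enum B].

Definition external_differences (G : finZmodType) (m : nat)
    (D : 'I_m -> {set G}) (i : 'I_m) : seq G :=
  \big[cat/[::]]_(j < m | j != i) Delta (D i) (D j).

Record is_GSEDF (G : finZmodType) (v m : nat) (k lambda : 'I_m -> nat)
    (D : 'I_m -> {set G}) : Prop := {
  gsedf_order : #|G| = v;
  gsedf_size : 2 <= m;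
  gsedf_lambda_gt0 : forall i, 0 < lambda i;
  gsedf_disjoint : forall i j, i != j -> [disjoint D i & D j];
  gsedf_nonempty : forall i, D i != set0;
  gsedf_card : forall i, #|D i| = k i;
  gsedf_count : forall i (g : G), g != 0%R ->
    count_mem g (external_differences D i) = lambda i;
  gsedf_no0 : forall i, 0%R \notin external_differences D i
}.

(* Main.v *)
Require Import Defs.
From mathcomp Require Import all_boot all_algebra.

Set Implicit Arguments.
Unset Strict Implicit.
Unset Printing Implicit Defensive.

(** Counting differences gives [k_i (K - k_i) = lambda_i (v - 1)] with
    [K = k_1 + ... + k_m], so [p1 p2] divides [k_i (K - k_i)] for every [i]. As
    [0 < k_i < K <= p1 p2], one of the primes divides [k_i] only and the other
    divides [K - k_i] only. If both distributions of the primes occur, at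
    indices [i] and [j], then [p1 p2] divides [K - k_i - k_j], which lies
    strictly between [0] and [p1 p2] because [m >= 3]. If, say, [p1] divides
    every [k_i], summing [K - k_i] shows that [p2] divides [(m - 1) K], hence
    [m - 1], so that [K >= m p1 > p1 p2]. *)

Lemma size_Delta (G : finZmodType) (A B : {set G}) :
  size (Delta A B) = #|A| * #|B|.
Proof. by rewrite size_allpairs -!cardE. Qed.

Lemma size_external_differences (G : finZmodType) (m : nat)
    (D : 'I_m -> {set G}) (i : 'I_m) :
  size (external_differences D i) = #|D i| * (\sum_(j < m) #|D j| - #|D i|).
Proof.
rewrite (bigD1 i) //= addKn big_distrr /= /external_differences.
rewrite (big_morph size (@size_cat G) (erefl : size [::] = 0)).
by apply: eq_bigr => j _; rewrite size_Delta.
Qed.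

Lemma size_sum_count_mem (T : finType) (s : seq T) :
  size s = \sum_(x : T) count_mem x s.
Proof.
elim: s => [|y s IHs] /=; first by rewrite big1.
by rewrite big_split /= -IHs (bigD1 y) //= eqxx big1 // => x; rewrite eq_sym => /negPf->.
Qed.

(** Double count of the external differences of [D i]: by pairs on the left, by values on the right,
    where [0] contributes nothing and each of the [v.-1] nonzero elements contributes [lambda i]. *)
Lemma GSEDF_card_eq (G : finZmodType) (v m : nat) (k lambda : 'I_m -> nat)
    (D : 'I_m -> {set G}) (i : 'I_m) :
  is_GSEDF v k lambda D ->
  k i * (\sum_(j < m) k j - k i) = lambda i * v.-1.
Proof.
move=> [cardG _ _ _ _ cardD countD no0].
under eq_bigr do rewrite -cardD; rewrite -cardD -size_external_differences.
rewrite size_sum_count_mem (bigD1 (0%R : G)) //= (count_memPn (no0 i)) add0n.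
rewrite (eq_bigr (fun=> lambda i)) => [|g]; last exact: countD.
by rewrite sum_nat_const cardC1 cardG mulnC.
Qed.

Section PrimePair.

Variables (m : nat) (k : 'I_m -> nat).
Hypotheses (m_gt2 : 2 < m) (k_gt0 : forall i, 0 < k i).
Let K := \sum_(i < m) k i.

Lemma ltn_add2_sum (i j : 'I_m) : i != j -> k i + k j < K.
Proof.
move=> ne_ij; have [l /norP[ne_li ne_lj]] : exists l, ~~ ((l == i) || (l == j)).
  apply/existsP; apply: contraTT m_gt2; rewrite negb_exists => /forallP in_ij.
  (* Here [2] becomes the cardinal of [[set i; j]], which would contain all of ['I_m]. *)
  rewrite -leqNgt -[leqLHS]card_ord -[2]/(true.+1) -ne_ij -cards2.
  by apply: subset_leq_card; apply/subsetP=> l _; rewrite !inE -[_ || _]negbK.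
rewrite /K (bigD1 i) //= (bigD1 j) 1?eq_sym //= (bigD1 l) ?ne_li //=.
by rewrite ltn_add2l -addn1 leq_add2l ltn_addr ?k_gt0.
Qed.

Lemma ltn_sum (i : 'I_m) : k i < K.
Proof.
have [j ne_ji] : exists j, j != i.
  apply/existsP; apply: contraTT m_gt2; rewrite negb_exists => /forallP eq_i.
  rewrite -leqNgt -[leqLHS]card_ord -(cards1 i) ltnW // ltnS.
  by apply: subset_leq_card; apply/subsetP=> l _; rewrite !inE -[_ == _]negbK.
exact: leq_ltn_trans (leq_addl _ _) (ltn_add2_sum ne_ji).
Qed.

Variables (p q : nat).
Hypotheses (p_pr : prime p) (q_pr : prime q) (co_pq : coprime p q).
Hypothesis K_le : K <= p * q.

Lemma not_all_dvd :
  ~ (forall i, p %| k i /\ q %| K - k i).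
Proof.
move=> dvd_k.
have i0 : 'I_m by apply: Ordinal (ltnW (ltnW m_gt2)).
have [p_k q_Kk] := dvd_k i0.
(* Otherwise [q] also divides [k i0], so [p * q] divides a positive number below [K]. *)
have q'K : ~~ (q %| K).
  apply/negP=> q_K; have q_k : q %| k i0.
    by rewrite -(dvdn_subr (ltnW (ltn_sum i0)) q_K).
  have := leq_trans (ltn_sum i0) K_le.
  by rewrite ltnNge dvdn_leq // Gauss_dvd // p_k.
have q_m : q %| m.-1.
  rewrite -(Gauss_dvdl _ (_ : coprime q K)) ?prime_coprime //.
  (* The sum is [m * K - K], and [q] divides each of its terms. *)
  have -> : m.-1 * K = \sum_(i < m) (K - k i).
    rewrite sumnB => [|i _]; last exact: ltnW (ltn_sum i).
    by rewrite sum_nat_const card_ord -/K -{3}[K]mul1n -mulnBl subn1.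
  by apply: dvdn_sum => i _; case: (dvd_k i).
have q_lt : q < m.
  by rewrite -(ltn_predK m_gt2) ltnS dvdn_leq // -ltnS (ltn_predK m_gt2) ltnW.
suff: p * q < K by rewrite ltnNge K_le.
apply: (@leq_trans (m * p)); first by rewrite mulnC ltn_pmul2r ?prime_gt0.
rewrite -[m in m * p]card_ord -sum_nat_const; apply: leq_sum => i _.
by have [p_ki _] := dvd_k i; rewrite dvdn_leq.
Qed.

Lemma dvd_cross (i j : 'I_m) :
  p %| k i -> q %| K - k i -> q %| k j -> p %| K - k j -> False.
Proof.
move=> p_i q_i q_j p_j; have le_iK := ltnW (ltn_sum i).
have [eq_ij|ne_ij] := eqVneq i j.
  have := leq_trans (ltn_sum i) K_le.
  by rewrite ltnNge dvdn_leq // Gauss_dvd // p_i eq_ij.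
have lt_ijK := ltn_add2_sum ne_ij.
(* For [q], read this as [(K - k i) - k j]; for [p], as [(K - k j) - k i]. *)
have : p * q %| K - (k i + k j).
  rewrite Gauss_dvd // subnDA (dvdn_sub q_i q_j) andbT.
  by rewrite subnAC (dvdn_sub p_j p_i).
move/dvdn_leq; rewrite subn_gt0 => /(_ lt_ijK).
apply/negP; rewrite -ltnNge (leq_trans _ K_le) //.
by rewrite ltn_subrL addn_gt0 k_gt0 (leq_ltn_trans _ lt_ijK).
Qed.

Lemma dvd_split (i : 'I_m) :
  p * q %| k i * (K - k i) ->
  (p %| k i) && (q %| K - k i) \/ (q %| k i) && (p %| K - k i).
Proof.
move=> pq_dvd; have lt_iK := ltn_sum i.
have dvdP r : prime r -> r %| p * q -> (r %| k i) || (r %| K - k i).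
  by move=> r_pr r_pq; rewrite -Euclid_dvdM // (dvdn_trans r_pq).
(* Applied to both [k i] and [K - k i], this prevents the two primes from dividing the same
   factor. *)
have pq'small n : 0 < n -> n < K -> ~~ ((p %| n) && (q %| n)).
  move=> n_gt0 lt_nK; rewrite -Gauss_dvd //; apply/negP=> /(dvdn_leq n_gt0).
  by rewrite leqNgt (leq_trans lt_nK K_le).
have := pq'small _ (k_gt0 i) lt_iK.
have := pq'small (K - k i).
rewrite subn_gt0 ltn_subrL k_gt0 lt_iK (leq_ltn_trans _ lt_iK) // => /(_ isT isT).
have := dvdP _ p_pr (dvdn_mulr _ (dvdnn p)).
have := dvdP _ q_pr (dvdn_mull _ (dvdnn q)).
by do 4 case: (_ %| _) => //=; auto.
Qed.

End PrimePair.

Lemma prime_pair_not_dvd (p q m : nat) (k : 'I_m -> nat) :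
  prime p -> prime q -> p != q -> 2 < m -> (forall i, 0 < k i) ->
  \sum_(i < m) k i <= p * q ->
  ~ (forall i, p * q %| k i * (\sum_(j < m) k j - k i)).
Proof.
move=> p_pr q_pr ne_pq m_gt2 k_gt0 K_le pq_dvd.
have co_pq : coprime p q by rewrite prime_coprime // dvdn_prime2.
have split i := dvd_split m_gt2 k_gt0 p_pr q_pr co_pq K_le (pq_dvd i).
have i0 : 'I_m by apply: Ordinal (ltnW (ltnW m_gt2)).
(* The distribution of the primes at [i0] is imposed on every index by [dvd_cross]; the second case
   exchanges [p] and [q]. *)
case: (split i0) => /andP[d1 d2].
  apply: (@not_all_dvd m k m_gt2 k_gt0 p q) => // i.
  case: (split i) => /andP[d3 d4] //.
  by case: (@dvd_cross m k m_gt2 k_gt0 p q co_pq K_le i0 i).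
apply: (@not_all_dvd m k m_gt2 k_gt0 q p); rewrite 1?coprime_sym 1?[q * p]mulnC //.
move=> i; case: (split i) => /andP[d3 d4] //.
by case: (@dvd_cross m k m_gt2 k_gt0 p q co_pq K_le i i0).
Qed.

Theorem theorem3p2 (p1 p2 m : nat) (k lambda : 'I_m -> nat) :
  prime p1 -> prime p2 -> p1 <> p2 -> 3 <= m ->
  (forall i : 'I_m, 0 < k i) -> (forall i : 'I_m, 0 < lambda i) ->
  \sum_(i < m) k i <= p1 * p2 ->
  forall G : finZmodType,
    ~ exists D : 'I_m -> {set G}, is_GSEDF (p1 * p2 + 1) k lambda D.
Proof.
move=> p1_pr p2_pr /eqP ne_p m_gt2 k_gt0 _ K_le G [D gsedfD].
apply: (@prime_pair_not_dvd p1 p2 m k) => // i.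
(* The group order minus one is exactly [p1 * p2]. *)
by rewrite (GSEDF_card_eq i gsedfD) addn1 dvdn_mull.
Qed.
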